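(* For an integer $k\geq 2$ let $M_k=2^k-1$ be the $k$-th Mersenne number ($k$ is not required to be prime). Then, as polynomials in $d$, $$ S_{M_k}(d) = \prod_{i=0}^{k-1} T_{2^i}(d).$$
   Context: The Chebyshev polynomials of the first kind $T_n(d)\in\mathbb{Z}[d]$ are normalized by $T_0(d)=2$, $T_1(d)=d$, $T_n(d)=d\,T_{n-1}(d)-T_{n-2}(d)$. The Chebyshev polynomials of the second kind $S_n(d)\in\mathbb{Z}[d]$ are normalized by $S_0(d)=1$, $S_1(d)=d$, $S_n(d)=d\,S_{n-1}(d)-S_{n-2}(d)$. *)

(* Defs.v *)
From HB Require Import structures.
From mathcomp Require Import all_boot all_order all_algebra.

Set Implicit Arguments.
Unset Strict Implicit.
Unset Printing Implicit Defensive.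

Import GRing.Theory.
Local Open Scope ring_scope.

(* Chebyshev polynomials in the normalization T_n(t + 1/t) = t^n + t^-n and
   S_n(t + 1/t) = t^n + t^(n-2) + ... + t^-n, so that T_0 = 2 rather than 1;
   the variable d is 'X. *)
Fixpoint chebT (n : nat) : {poly int} :=
  match n with
  | 0%N => 2
  | 1%N => 'X
  | (m.+1 as p).+1 => 'X * chebT p - chebT m
  end.

Fixpoint chebS (n : nat) : {poly int} :=
  match n with
  | 0%N => 1
  | 1%N => 'X
  | (m.+1 as p).+1 => 'X * chebS p - chebS m
  end.

Definition mersenne (k : nat) : nat := (2 ^ k - 1)%N.

(* Main.v *)
(** The addition formula S_(m+n+2) = S_(m+1) S_(n+1) - S_m S_n, taken at
    consecutive indices, together with T_(n+2) = S_(n+2) - S_n, gives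
    S_(2n-1) = S_(n-1) T_n.  Since M_(k+1) = 2 * 2^k - 1, applying this with
    n = 2^k splits off the factors T_(2^k) one at a time. *)
Require Import Defs.
From HB Require Import structures.
From mathcomp Require Import all_boot all_order all_algebra.
From mathcomp Require Import ring zify.

Import GRing.Theory.
Local Open Scope ring_scope.

Lemma chebSSS n : chebS n.+2 = 'X * chebS n.+1 - chebS n.
Proof. by []. Qed.

Lemma chebTSS n : chebT n.+2 = 'X * chebT n.+1 - chebT n.
Proof. by []. Qed.

(** By the recurrence, the right-hand side is unchanged when one unit moves from [m] to [n]; at
    [m = 0] it is the recurrence itself. *)
Lemma chebS_add m n :
  chebS (m + n).+2 = chebS m.+1 * chebS n.+1 - chebS m * chebS n.
Proof.
elim: m n => [|m IHm] n; first by rewrite add0n chebSSS /= mul1r.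
by rewrite addSnnS IHm !chebSSS; ring.
Qed.

Lemma chebT_chebS n : chebT n.+2 = chebS n.+2 - chebS n.
Proof.
(* The recurrence has order two, so the induction carries two consecutive indices. *)
suff: chebT n.+2 = chebS n.+2 - chebS n /\
      chebT n.+3 = chebS n.+3 - chebS n.+1 by case.
elim: n => [|n [IH0 IH1]]; first by rewrite !chebTSS !chebSSS /=; split; ring.
split=> //; rewrite chebTSS IH0 IH1 (chebSSS n.+2) {3}(chebSSS n); ring.
Qed.

Lemma chebS_double n : chebS (n.*2).+1 = chebS n * chebT n.+1.
Proof.
(* [chebT_chebS] starts at index 2, so [n = 0] is separate. *)
case: n => [|n]; first by rewrite /= mul1r.
have -> : (n.+1.*2).+1 = (n.+1 + n).+2 by lia.
by rewrite chebS_add chebT_chebS; ring.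
Qed.

Lemma chebS_mersenne k :
  chebS (mersenne k) = \prod_(0 <= i < k) chebT (2 ^ i)%N.
Proof.
elim: k => [|k IHk]; first by rewrite big_nil.
(* Positivity makes the truncated subtraction in [mersenne] exact. *)
have pow_gt0 : (0 < 2 ^ k)%N by rewrite expn_gt0.
have -> : mersenne k.+1 = ((mersenne k).*2).+1.
  by rewrite /mersenne expnS; lia.
rewrite chebS_double big_nat_recr // -IHk.
by congr (_ * chebT _); rewrite /mersenne subn1 prednK.
Qed.

Theorem corollary2p6 (k : nat) (hk : (2 <= k)%N) :
  chebS (mersenne k) = \prod_(0 <= i < k) chebT (2 ^ i)%N.
Proof. exact: chebS_mersenne. Qed.
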